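(* Let $K$ be a number field and $A$ its ring of integers. Then $A$ is finitely coverable if and only if there exists a prime number $p$ such that either $p \mid I(K)$, or there are at least $p$ prime ideals of $A$ lying over $p\mathbb{Z}$ with residual degree equal to $1$.
   Context: Convention: all rings are commutative, and a subring of a ring $R$ is an additive subgroup of $R$ closed under multiplication; it is not required to contain the identity. A subring is proper if it is different from $R$. A ring $R$ is coverable if it is the union of its proper subrings, and finitely coverable if it is the union of finitely many proper subrings. Let $\hat{A}$ be the set of elements $\theta\in A$ with $\mathbb{Q}(\theta)=K$; for $\theta\in\hat A$ let $I(\theta)=[A:\mathbb{Z}[\theta]]$ be the group index, and $I(K)=\gcd_{\theta\in\hat{A}} I(\theta)$. A prime $p$ dividing $I(K)$ is called a common index divisor. *)

(* Defs.v *)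
From HB Require Import structures.
From mathcomp Require Import all_boot all_order all_algebra all_field.
From mathcomp Require Import boolp classical_sets cardinality.

Set Implicit Arguments.
Unset Strict Implicit.
Unset Printing Implicit Defensive.

Import GRing.Theory.

Local Open Scope classical_set_scope.
Local Open Scope card_scope.
Local Open Scope ring_scope.

(* A subring need not contain 1. *)
Definition is_subring (R : comPzRingType) (S : set R) : Prop :=
  zmod_closed [in S] /\ GRing.mulr_2closed [in S].

Definition finitely_coverable (R : comPzRingType) : Prop :=
  exists (n : nat) (S : 'I_n -> set R),
    (forall i, is_subring (S i) /\ S i <> [set: R]) /\
    \bigcup_i S i = [set: R].

(* The quotient type Quotient.quot H only exists for boolean predicates carrying a
   zmodClosed structure; the value 0 encodes an infinite index. *)
Definition group_index (V : zmodType) (H : zmodClosed V) : nat :=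
  xget 0%N [set n | [set: Quotient.quot H] #= `I_n].

(* The generator of the ideal spanned by S; it is 0 when S has no nonzero
   element. *)
Definition gcd_set (S : set nat) : nat :=
  xget 0%N [set g | (forall n, S n -> (g %| n)%N) /\
                    (forall d, (forall n, S n -> (d %| n)%N) -> (d %| g)%N)].

Section RingOfIntegers.
Variable K : fieldExtType rat.

Definition integral_pred (x : K) : bool :=
  `[< integralOver (intr : int -> K) x >].

Fact integral_pred_subring : subring_closed integral_pred.
Proof.
split; first by apply/asboolP; exact: integral1.
- by move=> x y /asboolP Ix /asboolP Iy; apply/asboolP; exact: integral_sub.
- by move=> x y /asboolP Ix /asboolP Iy; apply/asboolP; exact: integral_mul.
Qed.

HB.instance Definition _ :=
  GRing.isSubringClosed.Build K integral_pred integral_pred_subring.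

Record ringOfIntegers := RingOfIntegers {
  ringOfIntegers_val :> K;
  _ : integral_pred ringOfIntegers_val
}.

HB.instance Definition _ := [isSub for ringOfIntegers_val].
HB.instance Definition _ := [Choice of ringOfIntegers by <:].
HB.instance Definition _ :=
  [SubChoice_isSubComNzRing of ringOfIntegers by <:].

End RingOfIntegers.

Section AdjoinInt.
Variables (R : comNzRingType) (theta : R).

Definition adjoin_int (x : R) : bool :=
  `[< exists q : {poly int}, x = (map_poly intr q).[theta] >].

Fact adjoin_int_subring : subring_closed adjoin_int.
Proof.
split.
- by apply/asboolP; exists 1; rewrite rmorph1 hornerE.
- move=> _ _ /asboolP[q ->] /asboolP[r ->]; apply/asboolP.
  by exists (q - r); rewrite rmorphB !hornerE.
- move=> _ _ /asboolP[q ->] /asboolP[r ->]; apply/asboolP.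
  by exists (q * r); rewrite rmorphM hornerM.
Qed.

HB.instance Definition _ :=
  GRing.isSubringClosed.Build R adjoin_int adjoin_int_subring.

End AdjoinInt.

(* I(theta) = [A : Z[theta]] *)
Definition int_index (K : fieldExtType rat) (theta : ringOfIntegers K) : nat :=
  group_index (GRing.ZmodClosed.clone _ (adjoin_int theta) _).

Definition integral_generators (K : fieldExtType rat) :
    set (ringOfIntegers K) :=
  [set theta | <<1; (theta : K)>>%VS = fullv].

Definition field_index (K : fieldExtType rat) : nat :=
  gcd_set [set int_index theta | theta in @integral_generators K].

Definition lies_over (R : comNzRingType) (P : {pred R}) (p : nat) : Prop :=
  forall z : int, (z%:~R \in P) = (p%:Z %| z)%Z.

(* f is the dimension of R/P over 'F_p; pPrimeCharType is R/P with its
   canonical 'F_p-module structure, available once R/P has characteristic p. *)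
Definition has_residue_degree (R : comNzRingType) (p : nat)
    (P : prime_idealr R) (f : nat) : Prop :=
  exists charP : p \in [pchar {ideal_quot P}],
    inhabited (Vector.axiom f (pPrimeCharType charP)).

(* Main.v *)
(* A is finitely generated as an abelian group: the trace form is integral on A
   and nondegenerate, so the coordinates of integral elements in an integral
   basis have a common denominator.  Every proper subgroup S of A therefore
   satisfies S + pA <> A for some prime p, and A/pA is finite.  With the Chinese
   remainder theorem it follows that A is finitely coverable iff for some prime p
   no theta generates A/pA as a ring without unit, i.e. no theta satisfies
   theta Z[theta] + pA = A.

   Such a theta generates K and has index prime to p.  Moreover its residues
   modulo the degree 1 primes above p are pairwise distinct and nonzero, so there
   are fewer than p of these primes.  Conversely, if Z[theta] + pA = A then for
   each c in {0, ..., p-1} the ideal (theta - c) + pA is either A or a degree 1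
   prime above p; if fewer than p such primes exist, some theta - c is a unit
   modulo p, and its positive powers then span A modulo p. *)
From HB Require Import structures.
Require Import Defs.
From mathcomp Require Import all_boot all_order all_fingroup all_algebra all_solvable all_field.
From mathcomp Require Import boolp classical_sets cardinality.
From mathcomp Require Import ring.

Set Implicit Arguments.
Unset Strict Implicit.
Unset Printing Implicit Defensive.

Import Order.TTheory GRing.Theory Num.Theory.

Local Open Scope classical_set_scope.
Local Open Scope card_scope.
Local Open Scope ring_scope.

(** * Finite generation of the ring of integers *)

(** Every complex eigenvalue of [M] is a root of the minimal polynomial, which divides [q], so it is
    an algebraic integer. The trace is the sum of the eigenvalues, and a rational algebraic integer
    is an integer. *)
Lemma integral_mxtrace n (M : 'M[rat]_n.+1) (q : {poly int}) :
  q \is monic -> horner_mx M (map_poly intr q) = 0 -> \tr M \is a Num.int.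
Proof.
move=> mon_q qM0; pose p := char_poly M.
have [r def_r] := closed_field_poly_normal (map_poly ratr p : {poly algC}).
have mon_p : map_poly ratr p \is @monic algC by rewrite map_monic char_poly_monic.
rewrite (monicP mon_p) scale1r in def_r.
have r_int z : z \in r -> z \in Aint.
  move=> zr; have: root (map_poly ratr p) z by rewrite def_r root_prod_XsubC.
  rewrite map_char_poly -eigenvalue_root_char eigenvalue_root_min mxminpoly_map.
  have /dvdpP[s def_q] := mxminpoly_min qM0.
  move=> rz; apply: (@root_monic_Aint (map_poly intr q)).
  - have -> : map_poly intr q = map_poly (@ratr algC) (map_poly intr q).
      by rewrite -map_poly_comp; apply: eq_map_poly => i /=; rewrite ratr_int.
    by rewrite def_q rmorphM rootM rz orbT.
  - exact: monic_map.
  - by apply/polyOverP => i; rewrite coef_map /=; apply: intr_int.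
have size_r : size r = n.+1.
  have := size_char_poly M; rewrite -/p -(size_map_poly (@ratr algC)) def_r.
  by rewrite size_prod_XsubC => -[].
have tr_r : ratr (\tr M) = \sum_(z <- r) z :> algC.
  apply: oppr_inj; rewrite -(coefPn_prod_XsubC (ps := r)) ?size_r // -def_r coef_map /=.
  by rewrite char_poly_trace // rmorphN.
have: (ratr (\tr M) : algC) \is a Num.int.
  apply: Cint_rat_Aint; first exact: Crat_rat.
  by rewrite tr_r big_seq; apply: rpred_sum => z /r_int.
move=> /intrP[m]; rewrite -(ratr_int algC) => /fmorph_inj ->; exact: intr_int.
Qed.

Section RegularRepresentation.
Variables (F : fieldType) (K : fieldExtType F) (n : nat) (b : n.+1.-tuple K).
Hypothesis b_basis : basis_of fullv b.

(** The proof that [b] is a basis is an argument so that the ring morphism structure, which needs a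
    basis, can be attached to [regular_mx b_basis]. *)
Definition regular_mx of basis_of fullv b := fun x : K =>
  (\matrix_(i, j) coord b j (tnth b i * x) : 'M[F]_n.+1).

Lemma coord_tnth_basis (v : K) : v = \sum_i coord b i v *: tnth b i.
Proof.
rewrite {1}(coord_basis b_basis (memvf v)); apply: eq_bigr => i _.
by rewrite (tnth_nth 0).
Qed.

Lemma regular_mx_is_zmod_morphism : zmod_morphism (regular_mx b_basis).
Proof. by move=> x y; apply/matrixP => i j; rewrite !mxE mulrBr linearB. Qed.

HB.instance Definition _ :=
  GRing.isZmodMorphism.Build K 'M[F]_n.+1 (regular_mx b_basis) regular_mx_is_zmod_morphism.

Lemma regular_mx_is_monoid_morphism : monoid_morphism (regular_mx b_basis).
Proof.
split=> [|x y]; apply/matrixP => i j; rewrite !mxE.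
  by rewrite mulr1 (tnth_nth 0) coord_free ?(basis_free b_basis) // eq_sym.
rewrite mulrA {1}(coord_tnth_basis (tnth b i * x)) mulr_suml linear_sum.
by apply: eq_bigr => k _; rewrite !mxE -scalerAl linearZ.
Qed.

HB.instance Definition _ :=
  GRing.isMonoidMorphism.Build K 'M[F]_n.+1 (regular_mx b_basis) regular_mx_is_monoid_morphism.

Lemma regular_mxZ a x : regular_mx b_basis (a *: x) = a *: regular_mx b_basis x.
Proof. by apply/matrixP => i j; rewrite !mxE -scalerAr linearZ. Qed.

End RegularRepresentation.

(** The regular representation is a ring morphism, so a monic integer polynomial that kills [x] also
    kills its matrix. *)
Lemma integral_trace (K : fieldExtType rat) n (b : n.+1.-tuple K)
    (b_basis : basis_of fullv b) (x : K) :
  integralOver intr x -> \tr (regular_mx b_basis x) \is a Num.int.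
Proof.
case=> q mon_q /rootP qx0; apply: (integral_mxtrace mon_q).
have /= := horner_map (regular_mx b_basis) (map_poly intr q) x.
rewrite qx0 rmorph0 => <-; rewrite /horner_mx /= /horner_morph -!map_poly_comp.
congr _.[_]; apply: eq_map_poly => i /=.
by rewrite !rmorph_int.
Qed.

(* Multiplying p by a power of its leading coefficient c gives a monic polynomial
   in c X. *)
Lemma lead_coef_integral (R : comNzRingType) (p : {poly int}) (x : R) :
  p != 0 -> root (map_poly intr p) x ->
  integralOver (intr : int -> R) ((lead_coef p)%:~R * x).
Proof.
move=> p0 /rootP px0; set c := lead_coef p.
have [d size_p] : exists d, size p = d.+1.
  by exists (size p).-1; rewrite prednK // size_poly_gt0.
(* A nonzero constant has a root only if its image in [R] vanishes, and then [c * x = 0]. *)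
case: d => [|d] in size_p.
  have /size_poly1P[a a0 def_p] : size p == 1%N by rewrite size_p.
  have ax0 : a%:~R = 0 :> R by move: px0; rewrite def_p map_polyC hornerC.
  by rewrite /c def_p lead_coefC ax0 mul0r; exact: integral0.
(* Chosen so that [r(c X) = c^d p(X)], where [p] has degree [d + 1]. *)
pose r : {poly int} := 'X^(d.+1) + \poly_(i < d.+1) (p`_i * c ^+ (d - i)).
exists r.
  by apply/monicP; rewrite lead_coefDl ?lead_coefXn // size_polyXn ltnS size_poly.
apply/rootP; rewrite rmorphD /= map_polyXn hornerD hornerXn.
transitivity (c%:~R ^+ d * (map_poly intr p).[x] : R); last by rewrite px0 mulr0.
rewrite (@horner_coef_wide _ d.+2 (map_poly intr p)); last first.
  by rewrite -size_p; exact: size_poly.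
rewrite (@horner_coef_wide _ d.+1); last first.
  by apply: (leq_trans (size_poly _ _)); exact: size_poly.
rewrite [in RHS]big_ord_recr /= addrC mulrDr.
rewrite mulr_sumr; congr (_ + _).
  rewrite coef_map /=; have -> : p`_d.+1 = c by rewrite /c /lead_coef size_p.
  by rewrite mulrA -exprSr exprMn.
apply: eq_bigr => i _; rewrite !coef_map /= coef_poly ltn_ord rmorphM rmorphXn /= exprMn.
have -> : c%:~R ^+ d = c%:~R ^+ (d - i) * c%:~R ^+ i :> R.
  by rewrite -exprD subnK // -ltnS.
ring.
Qed.

(** Clearing denominators in the minimal polynomial of [x] gives an integer polynomial, whose
    leading coefficient serves as [c]. *)
Lemma integral_multiple (K : fieldExtType rat) (x : K) :
  exists2 c : int, c != 0 & integralOver intr (c%:~R * x).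
Proof.
have /polyOver1P[q def_q] := minPolyOver 1%AS x.
have qx0 : root (map_poly (in_alg K) q) x by rewrite -def_q root_minPoly.
have q0 : q != 0.
  have := monic_minPoly 1%AS x; rewrite def_q => /monic_neq0.
  by rewrite map_poly_eq0.
have [p [a a0 def_p]] := rat_poly_scale q.
have p0 : p != 0 by apply: contra q0 => /eqP p0; rewrite def_p p0 rmorph0 scaler0.
exists (lead_coef p); first by rewrite lead_coef_eq0.
apply: lead_coef_integral => //.
have a1 : (a%:~R^-1 : rat)%:A != 0 :> K by rewrite scaler_eq0 oner_eq0 orbF invr_eq0 intr_eq0.
move: qx0; rewrite def_p map_polyZ /= rootZ //.
by rewrite -map_poly_comp; congr (root _ _); apply: eq_map_poly => i; rewrite /= scaler_int.
Qed.

Lemma integral_basis (K : fieldExtType rat) :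
  exists n, exists2 b : n.+1.-tuple K, basis_of fullv b &
    forall i, integralOver intr (tnth b i).
Proof.
have [n dimK] : exists n, \dim {:K} = n.+1.
  by exists (\dim {:K}).-1; rewrite prednK // adim_gt0.
pose b0 : n.+1.-tuple K := tcast dimK (vbasis {:K}).
have b0_basis : basis_of fullv b0 by rewrite /b0 val_tcast vbasisP.
have /choice[c cP] i : exists c : int, c != 0 /\ integralOver intr (c%:~R * tnth b0 i).
  by have [c] := integral_multiple (tnth b0 i); exists c.
exists n, [tuple (c i)%:~R * tnth b0 i | i < n.+1]; last first.
  by move=> i; rewrite tnth_mktuple; case: (cP i).
rewrite basisEdim size_tuple dimK leqnn andbT.
apply/subvP => v _; rewrite (coord_tnth_basis b0_basis v).
apply: memv_suml => i _; have [ci0 _] := cP i.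
have -> : tnth b0 i = (c i)%:~R^-1 *: ((c i)%:~R * tnth b0 i).
  by rewrite mulrzl -scaler_int scalerA mulVf ?scale1r ?intr_eq0.
by apply/memvZ/memvZ/memv_span/tnthP; exists i; rewrite tnth_mktuple.
Qed.

(** Cramer's rule for the Gram matrix [G] of the trace form: the coordinates of [x] times [G] are
    the traces of the [x * b_j], which are integers, so [D = \det G] clears all denominators. *)
Lemma integral_int_coord (K : fieldExtType rat) n (b : n.+1.-tuple K)
    (b_basis : basis_of fullv b) (b_int : forall i, integralOver intr (tnth b i)) :
  exists2 D : int, D != 0 & forall x : K, integralOver intr x ->
    exists z : 'I_n.+1 -> int, D%:~R * x = \sum_i tnth b i *~ z i.
Proof.
pose T x : rat := \tr (regular_mx b_basis x).
pose B i j : rat := T (tnth b i * tnth b j).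
have /choice[G1 G1P] (ij : 'I_n.+1 * 'I_n.+1) : exists z : int, B ij.1 ij.2 = z%:~R.
  by apply/intrP/integral_trace; exact: integral_mul (b_int _) (b_int _).
pose G : 'M[int]_n.+1 := \matrix_(i, j) G1 (i, j).
have T_coord x j : T (x * tnth b j) = \sum_i coord b i x * (G i j)%:~R.
  rewrite {1}(coord_tnth_basis b_basis x) mulr_suml /T rmorph_sum linear_sum /=.
  apply: eq_bigr => i _.
  by rewrite -scalerAl regular_mxZ linearZ /= mxE -G1P.
(* A vector x in the radical of the form would satisfy Tr (x * x^-1) = 0, but
   Tr 1 = n.+1. *)
have detG : \det G != 0.
  apply/eqP => detG; have /det0P[v v0 vG] : \det (map_mx (intr : int -> rat) G) == 0.
    by rewrite det_map_mx detG.
  pose x := \sum_i v 0 i *: tnth b i.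
  have coord_x i : coord b i x = v 0 i.
    rewrite /x; under eq_bigr do rewrite (tnth_nth 0).
    by rewrite coord_sum_free ?(basis_free b_basis).
  have x0 : x != 0.
    apply: contra v0 => /eqP x0; apply/eqP/rowP => i.
    by rewrite -coord_x x0 linear0 mxE.
  have Tx y : T (x * y) = 0.
    rewrite (coord_tnth_basis b_basis y) mulr_sumr /T rmorph_sum linear_sum /=.
    apply: big1 => j _; rewrite -scalerAr regular_mxZ linearZ /=.
    rewrite -/(T _) T_coord; under eq_bigr do rewrite coord_x.
    move/rowP/(_ j): vG; rewrite !mxE => vGj; rewrite [X in _ * X](_ : _ = 0) ?mulr0 //.
    by rewrite -[RHS]vGj; apply: eq_bigr => i _; rewrite !mxE.
  have := Tx x^-1; rewrite divff // /T rmorph1 mxtrace1 => /eqP.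
  by rewrite pnatr_eq0.
exists (\det G) => // x x_int.
have /choice[t tP] j : exists z : int, T (x * tnth b j) = z%:~R.
  by apply/intrP/integral_trace; exact: integral_mul x_int (b_int _).
pose z := (\row_j t j) *m \adj G.
exists (fun i => z 0 i).
have coord_z i : (\det G)%:~R * coord b i x = (z 0 i)%:~R.
  have : map_mx intr (\row_j t j) = (\row_i coord b i x) *m map_mx intr G :> 'rV[rat]_n.+1.
    by apply/rowP => j; rewrite !mxE -tP T_coord; apply: eq_bigr => k _; rewrite !mxE.
  move/(congr1 (mulmxr (map_mx intr (\adj G)))) => /=.
  rewrite -mulmxA -!map_mxM mul_mx_adj map_scalar_mx mul_mx_scalar => /rowP/(_ i).
  by rewrite !mxE => <-.
rewrite {1}(coord_tnth_basis b_basis x) mulr_sumr; apply: eq_bigr => i _.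
by rewrite mulrzl -scaler_int scalerA coord_z scaler_int.
Qed.

Definition fin_gen (V : zmodType) : Prop :=
  exists m (g : 'I_m -> V), forall x, exists z : 'I_m -> int, x = \sum_i g i *~ z i.

Lemma fin_gen_fintype (V : zmodType) (I : finType) (g : I -> V) :
  (forall x, exists z : I -> int, x = \sum_i g i *~ z i) -> fin_gen V.
Proof.
move=> gP; exists #|I|, (g \o enum_val) => x.
have [z ->] := gP x; exists (z \o enum_val).
by rewrite (reindex _ (onW_bij _ (@enum_val_bij I))).
Qed.

(** The colouring [c] by a finite type stands for reduction of integer vectors modulo [D]. *)
Lemma int_vector_mod m (D : int) : D != 0 ->
  exists (F : finType) (c : ('I_m -> int) -> F), forall z z', c z = c z' ->
    exists w : 'I_m -> int, forall i, z i = z' i + D * w i.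
Proof.
(* [|D|.-1.+1] is [|D|] in the successor form that [inord] requires. *)
move=> D0; exists {ffun 'I_m -> 'I_`|D|.-1.+1}.
exists (fun z => [ffun i => inord `|(z i %% D)%Z|]) => z z' /ffunP eq_mod.
have /choice[w wP] i : exists w, z i = z' i + D * w; last by exists w.
have /dvdzP[w def_w] : (D %| z i - z' i)%Z.
  rewrite -eqz_mod_dvd; move/(_ i)/(congr1 val): eq_mod; rewrite !ffunE.
  have lt_modD u : (`|(u %% D)%Z| < `|D|.-1.+1)%N.
    by rewrite prednK ?absz_gt0 // -ltz_nat gez0_abs ?modz_ge0 // ltz_mod.
  rewrite /= !inordK ?lt_modD // => e; apply/eqP.
  by rewrite -[LHS]gez0_abs ?modz_ge0 // e gez0_abs ?modz_ge0.
by exists w; rewrite mulrC -def_w addrC subrK.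
Qed.

Lemma fin_gen_mod (V : zmodType) (D : int) : fin_gen V -> D != 0 ->
  exists (F : finType) (c : V -> F), forall x y, c x = c y -> exists w, x = y + w *~ D.
Proof.
case=> m [g /choice[z zP]] D0; have [F [c cP]] := int_vector_mod m D0.
exists F, (c \o z) => x y /cP[w wP]; exists (\sum_i g i *~ w i).
rewrite {1}[x]zP {1}[y]zP mulrz_suml -big_split; apply: eq_bigr => i _ /=.
by rewrite wP mulrzDr mulrC mulrzA.
Qed.

(** Colour [x] by the coordinates of [D x] modulo [D]. Two elements of the same colour differ by an
    integer combination of the basis, so the basis and one representative of each colour
    generate. *)
Lemma ringOfIntegers_fin_gen (K : fieldExtType rat) : fin_gen (ringOfIntegers K).
Proof.
have [n [b b_basis b_int]] := integral_basis K.
have [D D0 DP] := integral_int_coord b_basis b_int.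
have intK (x : ringOfIntegers K) : integralOver intr (val x).
  by apply/asboolP; exact: (valP x).
have /choice[z zP] (x : ringOfIntegers K) := DP _ (intK x).
have [F [c cP]] := int_vector_mod n.+1 D0.
pose B i := RingOfIntegers (asboolT (b_int i)).
pose g (u : 'I_n.+1 + F) : ringOfIntegers K :=
  match u with inl i => B i | inr f => xget 0 [set x | c (z x) = f] end.
apply: (@fin_gen_fintype _ _ g) => x.
pose y := g (inr (c (z x))).
have : c (z y) = c (z x).
  by apply: (@xgetPex _ 0 [set y | c (z y) = c (z x)]); exists x.
move/esym/cP => [w wP].
exists (fun u => match u with inl i => w i | inr f => (f == c (z x))%:R end).
rewrite big_sumType /= [X in _ + X](bigD1 (c (z x))) //= eqxx mulr1z.
rewrite [X in _ + (_ + X)]big1 ?addr0 => [|f /negbTE->]; last by rewrite mulr0z.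
apply/eqP; rewrite -subr_eq; apply/eqP/val_inj.
have D0K : D%:~R != 0 :> K.
  by rewrite -(rmorph_int (in_alg K)) fmorph_eq0 intr_eq0.
apply: (mulfI D0K); rewrite rmorphB rmorph_sum mulrBr !zP -sumrB mulr_sumr.
apply: eq_bigr => i _; rewrite -mulrzBr wP addrC addKr raddfMz /= mulrzl -mulrzA.
by rewrite mulrC.
Qed.

(** * Subgroups modulo a prime *)

Section AdditiveSubgroups.
Variables (V : zmodType) (S : set V).
Hypothesis S_closed : zmod_closed [in S].

Lemma zmod_set0 : S 0.
Proof. by case: S_closed => /set_mem. Qed.

Lemma zmod_setB x y : S x -> S y -> S (x - y).
Proof. by case: S_closed => _ SB /mem_set Sx /mem_set Sy; exact/set_mem/SB. Qed.

Lemma zmod_setN x : S x -> S (- x).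
Proof. by move=> Sx; rewrite -[- x]add0r; exact: zmod_setB zmod_set0 Sx. Qed.

Lemma zmod_setD x y : S x -> S y -> S (x + y).
Proof. by move=> Sx Sy; rewrite -[y]opprK; apply/zmod_setB => //; exact: zmod_setN. Qed.

Lemma zmod_setMz x (k : int) : S x -> S (x *~ k).
Proof.
move=> Sx; have SMn n : S (x *+ n).
  elim: n => [|n IHn]; first exact: zmod_set0.
  by rewrite mulrS; exact: zmod_setD.
case: k => n; first exact: SMn.
by rewrite NegzE mulrNz; apply: zmod_setN; exact: SMn.
Qed.

Lemma zmod_set_sum (I : finType) (F : I -> V) : (forall i, S (F i)) -> S (\sum_i F i).
Proof. by move=> SF; elim/big_ind: _ => [|x y|i _] //; [exact: zmod_set0 | exact: zmod_setD]. Qed.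

End AdditiveSubgroups.

(** [J] is generated by its least positive element [d], and [p] is a prime factor of [d]. If [J] is
    zero, any prime will do. *)
Lemma int_subgroup_prime (J : set int) :
  zmod_closed [in J] -> ~ J 1 -> exists2 p : nat, prime p & forall k, J k -> (p%:Z %| k)%Z.
Proof.
move=> J_closed J1.
have [[k [Jk k0]]|J0] := pselect (exists k, J k /\ k != 0); last first.
  exists 2%N => // k Jk; have [->|k0] := eqVneq k 0; first exact: dvdz0.
  by case: J0; exists k.
have exd : exists d : nat, (0 < d)%N && `[< J d >].
  exists `|k|%N; rewrite absz_gt0 k0 /=; apply/asboolP.
  by rewrite abszE; case: (ger0P k) => _ //; exact: (zmod_setN J_closed Jk).
have [d /andP[d0 /asboolP Jd] d_min] := ex_minnP exd.
have d1 : d != 1%N by apply/eqP => d1; apply: J1; rewrite d1 in Jd.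
exists (pdiv d); first by rewrite pdiv_prime // ltn_neqAle eq_sym d1.
move=> l Jl; apply: (@dvdz_trans d%:Z); first by rewrite dvdzE /= pdiv_dvd.
apply/dvdz_mod0P/eqP; apply: contraT => r0.
have dn0 : d%:Z != 0 by rewrite -lt0n.
have Jr : J (l %% d%:Z)%Z.
  rewrite /modz; apply: zmod_setB => //; rewrite mulrC -mulrzz.
  exact: zmod_setMz.
have r_ge0 := modz_ge0 l dn0.
have := d_min `|(l %% d)%Z|%N.
rewrite absz_gt0 r0 gez0_abs //= => /(_ (asboolT Jr)).
rewrite leqNgt -ltz_nat gez0_abs // => /negP[]; rewrite -[X in _ < X]gez0_abs //.
exact: ltz_mod.
Qed.

(** Induction on the number of elements that generate [V] together with [S]. Let [S'] be [S]
    enlarged by the last of them, [h m]. If [S'] is proper, the induction hypothesis applies to it;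
    otherwise [V / S] is cyclic and [J] is the annihilator of its generator. *)
Lemma proper_subgroup_mod_prime (V : zmodType) (S : set V) :
  fin_gen V -> zmod_closed [in S] -> S <> [set: V] ->
  exists2 p : nat, prime p & exists x, forall s y, S s -> x <> s + y *+ p.
Proof.
case=> m [g gP] S_closed S_proper.
have {g gP}[h hP] : exists h : nat -> V,
    forall x, exists2 s, S s & exists z : nat -> int, x = s + \sum_(i < m) h i *~ z i.
  exists (fun i => if insub i is Some j then g j else 0) => x.
  have [z ->] := gP x; exists 0; first exact: zmod_set0.
  exists (fun i => if insub i is Some j then z j else 0); rewrite add0r.
  by apply: eq_bigr => i _; rewrite valK.
elim: m => [|m IHm] in h S S_closed S_proper hP *.
  case: S_proper; apply/seteqP; split=> // x _.
  by have [s Ss [z]] := hP x; rewrite big_ord0 addr0 => ->.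
pose S' := [set x | exists2 s, S s & exists k : int, x = s + h m *~ k].
have S'_closed : zmod_closed [in S'].
  split; first by apply/mem_set; exists 0; [exact: zmod_set0 | exists 0; rewrite mulr0z addr0].
  move=> _ _ /set_mem[s Ss [k ->]] /set_mem[t St [l ->]]; apply/mem_set.
  exists (s - t); first exact: zmod_setB.
  by exists (k - l); rewrite mulrzBr opprD addrACA.
have [S'V|S'_proper] := pselect (S' = [set: V]); last first.
  have [|p p_prime [x xP]] := IHm h S' S'_closed S'_proper.
    move=> x; have [s Ss [z ->]] := hP x; exists (s + h m *~ z m).
      by exists s => //; exists (z m).
    by exists z; rewrite big_ord_recr /= addrA addrAC.
  exists p => //; exists x => s y Ss; apply: xP; exists s => //.
  by exists 0; rewrite mulr0z addr0.
pose J := [set k : int | S (h m *~ k)].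
have J_closed : zmod_closed [in J].
  split; first by apply/mem_set; rewrite /J /= mulr0z; exact: zmod_set0.
  move=> k l /set_mem Jk /set_mem Jl; apply/mem_set.
  by rewrite /J /= mulrzBr; exact: zmod_setB.
have J1 : ~ J 1.
  rewrite /J /= mulr1z => Sh; case: S_proper; apply/seteqP; split=> // x _.
  have : S' x by rewrite S'V.
  by case=> s Ss [k ->]; exact: (zmod_setD S_closed Ss (zmod_setMz S_closed k Sh)).
have [p p_prime pJ] := int_subgroup_prime J_closed J1.
exists p => //; exists (h m) => s y Ss def_h.
have [t St [k def_y]] : S' y by rewrite S'V.
(* Substituting [y = t + k h_m] into [h_m = s + p y] gives [(1 - p k) h_m = s + p t], which lies in
   [S]. *)
have /pJ : J (1 - p%:Z * k).
  have e : h m - h m *~ (p%:Z * k) = s + t *+ p.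
    by rewrite {1}def_h def_y mulrnDl addrA [p%:Z * k]mulrC mulrzA -pmulrn addrK.
  rewrite /J /= mulrzBr mulr1z e pmulrn.
  exact: (zmod_setD S_closed Ss (zmod_setMz S_closed p St)).
move=> p_dvd; have := rpredD p_dvd (dvdz_mulr k (dvdzz p)); rewrite subrK.
by rewrite dvdz1 /= => /eqP p1; rewrite p1 in p_prime.
Qed.

(** The determinant trick: [g_i = s_i + p \sum_j M_ij g_j] says that [C = 1 - p M] maps the
    generators to elements of [S]. Multiplying by the adjugate puts each [\det C * g_k] in [S], and
    [\det C] is 1 modulo [p]. *)
Lemma nakayama_mod_prime (V : zmodType) (S : set V) (p : nat) :
  fin_gen V -> zmod_closed [in S] -> prime p ->
  (forall x, exists2 s, S s & exists y, x = s + y *+ p) ->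
  exists2 N : int, (p%:Z %| N - 1)%Z & forall x, S (x *~ N).
Proof.
case=> m [g gP] S_closed p_prime SpV.
have /choice[s sP] i : exists s, S s /\ exists y, g i = s + y *+ p.
  by have [s Ss] := SpV (g i); exists s.
have /choice[M MP] i : exists M : 'I_m -> int, g i = s i + (\sum_j g j *~ M j) *+ p.
  by have [_ [y def_gi]] := sP i; have [M def_y] := gP y; exists M; rewrite -def_y.
pose C : 'M[int]_m := 1%:M - p%:Z *: \matrix_(i, j) M i j.
have def_s i : s i = \sum_j g j *~ C i j.
  rewrite -[LHS](addrK ((\sum_j g j *~ M i j) *+ p)) -MP -sumrMnl.
  transitivity (\sum_j (g j *~ (i == j)%:R - g j *~ M i j *+ p)).
    rewrite sumrB; congr (_ - _); rewrite (bigD1 i) //= eqxx mulr1z big1 ?addr0 // => j /negbTE ji.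
    by rewrite eq_sym ji mulr0z.
  by apply: eq_bigr => j _; rewrite !mxE mulrzBr [p%:Z * _]mulrC mulrzA -pmulrn.
exists (\det C).
  have p_char : p \in [pchar 'F_p] by exact: pchar_Fp.
  rewrite (dvdz_pcharf p_char) rmorphB rmorph1 subr_eq0 -det_map_mx.
  rewrite map_mxB map_mx1 map_mxZ /= -pmulrn (pcharf0 p_char) scale0r subr0.
  by rewrite det1.
have S_detg k : S (g k *~ \det C).
  have -> : g k *~ \det C = \sum_i s i *~ (\adj C) k i.
    transitivity (\sum_j g j *~ (\adj C *m C) k j).
      rewrite mul_adj_mx (bigD1 k) //= !mxE eqxx mulr1n big1 ?addr0 // => j /negbTE jk.
      by rewrite !mxE eq_sym jk mulr0z.
    under eq_bigr do rewrite mxE mulrz_sumr.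
    rewrite exchange_big /=; apply: eq_bigr => i _.
    rewrite def_s mulrz_suml; apply: eq_bigr => j _.
    by rewrite mulrC mulrzA.
  by apply: zmod_set_sum => // i; apply: zmod_setMz => //; case: (sP i).
move=> x; have [z ->] := gP x; rewrite mulrz_suml; apply: zmod_set_sum => // i.
by rewrite -mulrzA mulrC mulrzA; exact: zmod_setMz.
Qed.

(** * Torsion in finite abelian groups and the index of a subgroup *)

Lemma finZmod_mulrn_card (G : finZmodType) (x : G) : x *+ #|G| = 0.
Proof.
rewrite -cardsT; have /dvdnP[k ->] := @order_dvdG G [set: G]%G x (finset.in_setT x).
by rewrite mulnC mulrnA -[x *+ _]FinRing.zmodXgE expg_order mul0rn.
Qed.

Lemma finZmod_Cauchy (G : finZmodType) (p : nat) :
  prime p -> (p %| #|G|)%N -> exists2 x : G, x != 0 & x *+ p = 0.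
Proof.
move=> p_prime; rewrite -cardsT => /(Cauchy p_prime)[x _ ox]; exists x.
  by apply/eqP => x0; move: ox; rewrite x0 order1 => p1; rewrite -p1 in p_prime.
by rewrite -FinRing.zmodXgE -ox expg_order.
Qed.

(** The bijection with [I_n] gives [V] a finite group structure, to which Lagrange's and Cauchy's
    theorems apply. *)
Lemma finite_zmod_torsion (V : zmodType) n : [set: V] #= `I_n ->
  (forall x : V, x *+ n = 0) /\
  (forall p : nat, prime p -> (p %| n)%N -> exists2 x : V, x != 0 & x *+ p = 0).
Proof.
move=> /card_set_bijP[f [f_fun f_inj f_surj]].
have fP x : (f x < n)%N by exact: f_fun.
pose h x := Ordinal (fP x).
have /choice[g gK] i : exists x, h x = i.
  by have [x _ fx] := f_surj i (ltn_ord i); exists x; apply: val_inj.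
have hK : cancel h g.
  by move=> x; apply: f_inj; rewrite ?inE //; exact: (congr1 val (gK (h x))).
pose cV := HB.pack_for countType V (CanIsCountable hK).
pose G := HB.pack_for finZmodType V (CanIsCountable hK) (@CanIsFinite cV _ h g hK).
have cardG : #|G| = n.
  by rewrite -(card_ord n); apply: (bij_eq_card (f := h : G -> _)); exists g.
split=> [x | p p_prime]; rewrite -cardG; first exact: (@finZmod_mulrn_card G x).
exact: (@finZmod_Cauchy G p p_prime).
Qed.

(** If [S] has a nonzero element, it bounds the common divisors, and their least common multiple is
    again a common divisor. Otherwise the gcd is 0. *)
Lemma gcd_setP (S : set nat) :
  (forall n, S n -> (gcd_set S %| n)%N) /\
  (forall d, (forall n, S n -> (d %| n)%N) -> (d %| gcd_set S)%N).
Proof.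
pose isgcd g := (forall n, S n -> (g %| n)%N) /\
  (forall d, (forall n, S n -> (d %| n)%N) -> (d %| g)%N).
suff [g gP] : exists g, isgcd g by exact: (@xgetPex _ 0%N isgcd (ex_intro _ g gP)).
have [[n [Sn n0]]|S0] := pselect (exists n, S n /\ n != 0%N); last first.
  exists 0%N; split=> // n Sn; rewrite dvd0n; apply: contraT => n0.
  by case: S0; exists n.
pose cd d := `[< forall n, S n -> (d %| n)%N >].
exists (\big[lcmn/1%N]_(d < n.+1 | cd d) d); split=> [k Sk | d dS].
  by elim/big_ind: _ => // [x y xk yk | d /asboolP/(_ k Sk)//]; rewrite dvdn_lcm xk.
have d_n : (d < n.+1)%N by rewrite ltnS dvdn_leq ?lt0n // dS.
by rewrite (bigD1 (Ordinal d_n)) /= ?dvdn_lcml //; apply/asboolP.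
Qed.

Lemma neq0_mod_prime (p : nat) (N : int) : prime p -> (p%:Z %| N - 1)%Z -> N != 0.
Proof.
move=> p_prime; apply: contraTneq => ->; rewrite sub0r dvdzE /= dvdn1.
by apply: contraTneq p_prime => ->.
Qed.

Section GroupIndex.
Variables (V : zmodType) (H : zmodClosed V).

Local Notation proj := (\pi_(Quotient.quot H))%qT.

Lemma quot_pi_eq0 x : (proj x == 0) = (x \in H).
Proof. by rewrite -[x in RHS]subr0 Quotient.idealrBE raddf0. Qed.

(** The index [n] kills the quotient, and Bezout's [u p = v n + 1] splits [x] as
    [- v n x + u p x]. *)
Lemma group_index_mod_prime (p : nat) : prime p -> ~~ (p %| group_index H)%N ->
  forall x, exists2 s, s \in H & exists y, x = s + y *+ p.
Proof.
move=> p_prime; rewrite /group_index.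
(* The value 0 for an infinite index is divisible by [p], so this case is excluded. *)
have [n|_] := xgetP; last by rewrite dvdn0.
move=> _ nP p_n x; have [nV _] := finite_zmod_torsion nP.
have xn : x *+ n \in H by rewrite -quot_pi_eq0 raddfMn /= nV.
have [u v uv _] := egcdnP n (prime_gt0 p_prime).
exists (- (x *+ n *+ v)); first by rewrite rpredN rpredMn.
have /eqP p_n1 : coprime p n by rewrite prime_coprime.
exists (x *+ u); rewrite -[x *+ u *+ p]mulrnA uv p_n1 addn1 mulrS mulnC mulrnA.
by rewrite [x + _]addrC addKr.
Qed.

(** [N] kills the quotient, which is therefore finite. If [p] divided its order, Cauchy's theorem
    would give a nonzero [q] with [p q = 0]; but [N q = 0] and [N] is 1 modulo [p], so [q = 0]. *)
Lemma group_index_coprime (p : nat) (N : int) : fin_gen V -> prime p ->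
  (p%:Z %| N - 1)%Z -> (forall x, x *~ N \in H) -> ~~ (p %| group_index H)%N.
Proof.
move=> V_fg p_prime pN NV.
have N0 := neq0_mod_prime p_prime pN.
have [F [c cP]] := fin_gen_mod V_fg N0.
have fin_quot : finite_set [set: Quotient.quot H].
  rewrite -(preimage_setT (c \o generic_quotient.repr)); apply: finite_preimage;
    last exact: finite_finset.
  move=> q r _ _ /= /cP[w def_q]; rewrite -[q]reprK -[r]reprK.
  by apply/eqP; rewrite -Quotient.idealrBE def_q addrC addKr.
rewrite /group_index; have [n|n_none] := xgetP; last first.
  by case/finite_setP: fin_quot => n /n_none.
move=> _ /finite_zmod_torsion[_ pV]; apply/negP => /(pV p p_prime)[q q0 qp].
case/negP: q0; rewrite -[q]reprK.
have /dvdzP[k def_N] := pN.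
have : proj (generic_quotient.repr q *~ N) == 0 by rewrite quot_pi_eq0.
by rewrite raddfMz /= reprK -(subrK 1 N) def_N mulrzDr mulr1z mulrC mulrzA -pmulrn qp mul0rz add0r.
Qed.

End GroupIndex.

(** * Generation modulo p and primes of degree 1 *)

Lemma horner_sub_factor (R : comNzRingType) (p : {poly R}) (x y : R) :
  exists w, p.[x] - p.[y] = w * (x - y).
Proof.
have /factor_theorem[r def_r] : root (p - (p.[y])%:P) y.
  by rewrite rootE !hornerE subrr.
exists r.[x]; have -> : p.[x] - p.[y] = (p - (p.[y])%:P).[x] by rewrite !hornerE.
by rewrite def_r !hornerE.
Qed.

Definition int_horner (R : comNzRingType) (q : {poly int}) (x : R) : R :=
  (map_poly intr q).[x].

(* The powers x, x^2, ... (without 1) span R modulo p. *)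
Definition generates_mod (R : comNzRingType) (p : nat) (x : R) : Prop :=
  forall y : R, exists q a, y = int_horner q x * x + a *+ p.

Section ModPrime.
Variables (R : comNzRingType) (p : nat).
Implicit Types (x y : R) (P : prime_idealr R).

Lemma int_horner_factor q x (k : int) :
  exists w, int_horner q x - (q.[k])%:~R = w * (x - k%:~R).
Proof. by rewrite -horner_map; exact: horner_sub_factor. Qed.

Lemma generates_mod_congr x y w :
  generates_mod p x -> y = x + w *+ p -> generates_mod p y.
Proof.
move=> xP def_y z; have [q [a ->]] := xP z.
have [u qyx] := horner_sub_factor (map_poly intr q) y x.
(* Both [q(x)] and the factor [x] change by multiples of [p]; the last two terms collect these
   changes. *)
exists q, (a - int_horner q y * w - u * w * x).
have yx : y - x = w *+ p by rewrite def_y addrC addKr.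
have -> : int_horner q x = int_horner q y - u * (w *+ p).
  by rewrite -yx -qyx subKr.
have [r mulp] : exists r : R, forall v, v *+ p = v * r.
  by exists p%:R => v; rewrite mulr_natr.
by move: (int_horner q y) => e; rewrite def_y !mulp; ring.
Qed.

(** [R / P] is a line over ['F_p] spanned by the class of 1; the ratio of the coordinates of [x] and
    1 lifts to [k]. *)
Lemma residue_degree1_int P : has_residue_degree p P 1 ->
  forall x, exists k : int, x - k%:~R \in P.
Proof.
case=> charP [[f f_lin f_bij]] x.
have f_inj := bij_inj f_bij.
pose F : {linear pPrimeCharType charP -> 'rV['F_p]_1} :=
  HB.pack f (GRing.isLinear.Build _ _ _ _ f f_lin).
have f1 : f 1 0 0 != 0.
  apply: contra (oner_neq0 (pPrimeCharType charP)) => /eqP f10.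
  apply/eqP/f_inj; rewrite -[f 0]/(F 0) raddf0; apply/rowP => i.
  by rewrite ord1 f10 mxE.
pose proj : R -> {ideal_quot P} := (\pi_({ideal_quot P}))%qT.
pose a : 'F_p := f (proj x) 0 0 / f 1 0 0.
have def_x : proj x = a *: (1 : pPrimeCharType charP).
  apply: f_inj; rewrite -[f (a *: 1)]/(F (a *: 1)) linearZ; apply/rowP => i.
  by rewrite !mxE ord1 mulfVK.
exists (a : nat)%:Z; rewrite Quotient.idealrBE.
apply/eqP; rewrite -[LHS]/(proj x) def_x.
by rewrite -pmulrn rmorph_nat /GRing.scale /= /pprimeChar_scale mulr1.
Qed.

(** Every class modulo [J] contains an integer and [J] meets the integers in the multiples of [p],
    so the quotient is ['F_p]. *)
Lemma degree1_prime_ideal (J : {pred R}) :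
  prime p -> zmod_closed J -> (forall a x, x \in J -> a * x \in J) ->
  lies_over J p -> (forall x, exists k : int, x - k%:~R \in J) ->
  exists P, [/\ P =i J, lies_over P p & has_residue_degree p P 1].
Proof.
move=> p_prime J_zmod JM J_over J_int.
have [J0 JB] := J_zmod.
have JB' x y : y \in J -> (x \in J) = (x - y \in J).
  move=> Jy; apply/idP/idP => [/JB|Jxy]; first exact.
  rewrite -[x](subrK y) -[y in _ + y]opprK; apply: (JB _ _ Jxy).
  by rewrite -sub0r; exact: JB.
have J_proper : 1 \notin J /\ forall a, {in J, forall u, a * u \in J}.
  split=> [|a u]; last exact: JM.
  by rewrite -[1]/(1%:~R) J_over dvdz1 absz_nat; apply: contraTN p_prime => /eqP->.
have J_prime : @prime_idealr_closed R J.
  (* Modulo [J] the product [u * v] is the integer [k * l], which reduces primality to Euclid's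
     lemma. *)
  move=> u v; have [k Jk] := J_int u; have [l Jl] := J_int v.
  rewrite (JB' u _ Jk) (JB' v _ Jl) !subKr (JB' (u * v) (u * (v - l%:~R))) ?JM //.
  rewrite (JB' _ (l%:~R * (u - k%:~R))) ?JM //.
  have -> : u * v - u * (v - l%:~R) - l%:~R * (u - k%:~R) = (k * l)%:~R.
    by rewrite intrM; ring.
  by rewrite !J_over !dvdzE abszM Euclid_dvdM.
pose P : prime_idealr R := HB.pack (J : R -> bool)
  (GRing.isZmodClosed.Build R J J_zmod) (isProperIdeal.Build R J J_proper)
  (isPrimeIdealrClosed.Build R J J_prime).
exists P; split=> //.
pose proj : {rmorphism R -> {ideal_quot P}} := (\pi_({ideal_quot P}))%qT.
have proj_int k : (k%:~R == 0 :> {ideal_quot P}) = (p%:Z %| k)%Z.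
  rewrite -J_over -[k%:~R in RHS]subr0; transitivity (proj (k%:~R) == proj 0).
    by rewrite rmorph_int rmorph0.
  by rewrite -Quotient.idealrBE.
have charP : p \in [pchar {ideal_quot P}] by rewrite inE p_prime /= -[_%:R]/(p%:~R) proj_int.
exists charP.
pose Q := pPrimeCharType charP.
have /choice[h hP] (y : Q) : exists a : 'F_p, a *: (1 : Q) = y.
  have [k Jk] := J_int (generic_quotient.repr y).
  exists k%:~R; rewrite scaler_int -[y](@reprK _ {ideal_quot P}).
  apply/esym/eqP; rewrite -[1 *~ k](rmorph_int proj).
  by rewrite -Quotient.idealrBE.
have scale1_inj : injective (fun a : 'F_p => a *: (1 : Q)).
  move=> a b /eqP; rewrite -subr_eq0 -scalerBl scaler_eq0 oner_eq0 orbF subr_eq0.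
  by move/eqP.
constructor; exists (fun z => const_mx (h z) : 'rV['F_p]_1).
  move=> a u v; apply/rowP => i; rewrite !mxE; apply: scale1_inj.
  by rewrite hP scalerDl -scalerA !hP.
exists (fun v : 'rV['F_p]_1 => v 0 0 *: (1 : Q)) => [z|v]; first by rewrite mxE hP.
by apply/rowP => i; rewrite ord1 mxE; apply: scale1_inj; rewrite hP.
Qed.

End ModPrime.

Section CommonIndexDivisors.
Variables (K : fieldExtType rat) (p : nat).
Hypothesis p_prime : prime p.
Local Notation A := (ringOfIntegers K).

(** Some multiple [c v] is integral, so [N c v] is a polynomial in [theta], and dividing by [N c]
    puts [v] in the field generated by [theta]. *)
Lemma Fadjoin_full_of_multiple (theta : A) (N : int) :
  N != 0 -> (forall x : A, x *~ N \in adjoin_int theta) ->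
  <<1; (theta : K)>>%VS = fullv.
Proof.
move=> N0 NA; apply/eqP; rewrite eqEsubv subvf; apply/subvP => v _.
have [c c0 cv] := integral_multiple v.
have /asboolP[q def_q] := NA (RingOfIntegers (asboolT cv)).
have Nc0 : (N * c)%:~R != 0 :> rat by rewrite intr_eq0 mulf_neq0.
have -> : v = (N * c)%:~R^-1 *: ((N * c)%:~R *: v) by rewrite scalerA mulVf ?scale1r.
apply: memvZ; have -> : (N * c)%:~R *: v = (map_poly intr q).[theta : K].
  transitivity (val ((map_poly intr q).[theta])).
    by rewrite -def_q raddfMz /= scaler_int mulrzl mulrC mulrzA.
  rewrite -horner_map -map_poly_comp; congr _.[_]; apply: eq_map_poly => i.
  by rewrite -[LHS]/(val (i%:~R)) rmorph_int.
apply: mempx_Fadjoin; apply/polyOverP => i; rewrite coef_map /=; exact: rpred_int.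
Qed.

(** By the determinant trick some [N], equal to 1 modulo [p], multiplies the whole ring into
    [Z[theta]]. So [theta] generates the field with index prime to [p], and the gcd divides that
    index. *)
Lemma generates_mod_index (theta : A) :
  generates_mod p theta -> ~~ (p %| field_index K)%N.
Proof.
move=> theta_p; have A_fg := ringOfIntegers_fin_gen K.
pose S := [set x : A | x \in adjoin_int theta].
have S_closed : zmod_closed [in S].
  split=> [|x y /set_mem Sx /set_mem Sy]; apply/mem_set; first exact: rpred0.
  exact: rpredB.
have [|N pN NA] := nakayama_mod_prime A_fg S_closed p_prime.
  move=> x; have [q [a ->]] := theta_p x; exists (int_horner q theta * theta); last by exists a.
  by apply/asboolP; exists (q * 'X); rewrite rmorphM /= map_polyX hornerMX.
have N0 := neq0_mod_prime p_prime pN.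
have := group_index_coprime (H := GRing.ZmodClosed.clone _ (adjoin_int theta) _) A_fg p_prime pN NA.
apply: contra => /dvdn_trans; apply.
case: (gcd_setP [set int_index theta | theta in @integral_generators K]) => + _.
by apply; exists theta => //; exact: Fadjoin_full_of_multiple N0 NA.
Qed.

Lemma index_generator : ~~ (p %| field_index K)%N ->
  exists theta : A, forall x, exists q a, x = int_horner q theta + a *+ p.
Proof.
move=> /negP p_index; apply: contrapT => no_theta; apply: p_index.
case: (gcd_setP [set int_index theta | theta in @integral_generators K]) => _; apply.
move=> _ [theta _ <-]; apply: contrapT => /negP p_theta; apply: no_theta.
exists theta => x.
have [s /asboolP[q ->] [a ->]] := group_index_mod_prime p_prime p_theta x.
by exists q, a.
Qed.

(** Membership in [P i] depends only on the residue [k i] of [theta], so distinct primes give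
    distinct residues. Then [p] primes exhaust ['F_p]; the one with residue 0 contains [theta],
    hence also 1. *)
Lemma generates_mod_primes (theta : A) :
  generates_mod p theta ->
  ~ exists P : 'I_p -> prime_idealr A,
      (forall i j : 'I_p, P i =i P j -> i = j) /\
      (forall i : 'I_p, lies_over (P i) p /\ has_residue_degree p (P i) 1%N).
Proof.
move=> theta_p [P [P_inj P_p]].
have /choice[k kP] i : exists k : int, theta - k%:~R \in P i.
  exact: (residue_degree1_int (P_p i).2).
have P_int i (l : int) : (l%:~R \in P i) = (p%:Z %| l)%Z by case: (P_p i).
have Pp i : p%:R \in P i by rewrite -[p%:R]/(p%:~R) P_int.
(* Stated for any integer [l] congruent to [theta], so that [P i] can also be tested with [k j]. *)
have memP i (l : int) q a : theta - l%:~R \in P i ->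
    (int_horner q theta * theta + a *+ p \in P i) = (p%:Z %| q.[l] * l)%Z.
  move=> theta_l; rewrite -(P_int i) rpredDr; last by rewrite -mulr_natr; apply: idealMr; exact: Pp.
  have [w qw] := int_horner_factor q theta l.
  rewrite -[int_horner q theta * theta](subrK (q.[l] * l)%:~R) rpredDl //.
  have -> : int_horner q theta * theta - (q.[l] * l)%:~R =
      (int_horner q theta + w * l%:~R) * (theta - l%:~R).
    have -> : int_horner q theta = w * (theta - l%:~R) + (q.[l])%:~R by rewrite -qw subrK.
    by rewrite intrM; ring.
  by rewrite idealMr.
pose kappa i : 'F_p := (k i)%:~R.
have kappa_inj : injective kappa.
  move=> i j /eqP; rewrite -subr_eq0 -rmorphB /= -(dvdz_pcharf (pchar_Fp p_prime)) => p_kij.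
  apply: P_inj => x; have [q [a ->]] := theta_p x.
  rewrite (memP i (k j)) ?(memP j (k j)) //.
  have -> : theta - (k j)%:~R = theta - (k i)%:~R + (k i - k j)%:~R.
    by rewrite intrB addrA subrK.
  by rewrite rpredD // P_int.
have /(inj_card_onto kappa_inj)/(_ 0)/codomP[i ki0] : (#|'F_p| <= #|'I_p|)%N.
  by rewrite card_Fp // card_ord.
have theta_P : theta \in P i.
  rewrite -[theta](subrK (k i)%:~R) rpredD // P_int (dvdz_pcharf (pchar_Fp p_prime)).
  by rewrite -/(kappa i) -ki0.
have [q [a one_def]] := theta_p 1.
have : 1 \in P i by rewrite one_def -[a *+ p]mulr_natr rpredD //; apply: idealMr => //; exact: Pp.
by rewrite idealr1.
Qed.

Lemma generates_mod_exists :
  ~~ (p %| field_index K)%N ->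
  ~ (exists P : 'I_p -> prime_idealr A,
      (forall i j : 'I_p, P i =i P j -> i = j) /\
      (forall i : 'I_p, lies_over (P i) p /\ has_residue_degree p (P i) 1%N)) ->
  exists theta : A, generates_mod p theta.
Proof.
move=> /index_generator[theta theta_p] noP.
pose J (c : 'I_p) : {pred A} :=
  fun x => `[< exists a b, x = a * (theta - c%:R) + b *+ p >].
have JB (c : 'I_p) : zmod_closed (J c).
  split=> [|_ _ /asboolP[a [b ->]] /asboolP[a' [b' ->]]]; apply/asboolP.
    by exists 0, 0; rewrite mul0r mul0rn addr0.
  by exists (a - a'), (b - b'); rewrite mulrBl mulrnBl opprD addrACA.
have JM (c : 'I_p) a x : x \in J c -> a * x \in J c.
  move=> /asboolP[b [b' ->]]; apply/asboolP.
  by exists (a * b), (a * b'); rewrite mulrDr mulrA mulrnAr.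
have Jtheta (c : 'I_p) : theta - c%:R \in J c.
  by apply/asboolP; exists 1, 0; rewrite mul1r mul0rn addr0.
have Jp (c : 'I_p) : p%:R \in J c by apply/asboolP; exists 0, 1; rewrite mul0r add0r.
(* If no [J c] is the unit ideal, these are [p] distinct primes of degree 1, contrary to [noP].
   Otherwise [theta - c] is a unit modulo [p] for some [c]. *)
have [[c /asboolP[u [b one_def]]]|J1] := pselect (exists c : 'I_p, 1 \in J c); last first.
  case: noP.
  have J_over (c : 'I_p) : lies_over (J c) p.
    move=> z; apply/idP/idP => [Jz|/dvdzP[w ->]]; last by rewrite intrM JM.
    apply: contra_notT J1 => p_z; exists c.
    have /coprimezP[[u v] /= uv] : coprimez p z.
      by rewrite coprimezE prime_coprime.
    have -> : 1 = u%:~R * p%:R + v%:~R * z%:~R :> A by rewrite -[p%:R]/(p%:~R) -!intrM -intrD uv.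
    have [J0 J_B] := JB c; rewrite -[v%:~R * _]opprK J_B ?JM //.
    by rewrite -sub0r J_B ?JM.
  have J_int (c : 'I_p) x : exists k : int, x - k%:~R \in J c.
    have [q [a ->]] := theta_p x; exists q.[c%:Z]; rewrite addrAC.
    have [w ->] := int_horner_factor q theta c.
    by apply/asboolP; exists w, a.
  have /choice[P PP] c := degree1_prime_ideal p_prime (JB c) (JM c) (J_over c) (J_int c).
  exists P; split=> [i j Pij | i]; last by case: (PP i).
  have [Pi _ _] := PP i; have [Pj Pj_over _] := PP j.
  have := Jtheta i; rewrite -Pi Pij => theta_i.
  have := Jtheta j; rewrite -Pj => theta_j.
  have := rpredB theta_i theta_j.
  have -> : theta - i%:R - (theta - j%:R) = (j%:Z - i%:Z)%:~R by rewrite intrB; ring.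
  rewrite Pj_over -eqz_mod_dvd.
  have ltp (c : 'I_p) : 0 <= c%:Z < p%:Z by rewrite le0z_nat ltz_nat ltn_ord.
  by rewrite !modz_small // => /eqP[ji]; apply: val_inj.
have [q [a def_u]] := theta_p u.
pose eta := theta - c%:R.
exists eta => x.
(* Substituting [X + c] turns a polynomial in [theta] into one in [eta]. *)
have shift (y : A) : exists r d, y = int_horner r eta + d *+ p.
  have [r [d ->]] := theta_p y; exists (r \Po ('X + (c%:Z)%:P)), d; congr (_ + _).
  rewrite /int_horner map_comp_poly horner_comp rmorphD /= map_polyX map_polyC /=.
  by rewrite !hornerE /eta subrK.
(* Since [1 = u eta + p b], expanding [x u] in powers of [eta] writes [x] without a constant term
   modulo [p]. *)
have [r [d ud]] := shift (x * u).
exists r, (d * eta + x * b).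
transitivity (x * (u * (theta - c%:R) + b *+ p)); first by rewrite -one_def mulr1.
have [s mulp] : exists s : A, forall v, v *+ p = v * s.
  by exists p%:R => v; rewrite mulr_natr.
by rewrite mulrDr mulrA ud !mulp /eta; ring.
Qed.

End CommonIndexDivisors.

(** * Finite coverings by subrings and generation modulo primes *)

Lemma chinese_remainder_primes (V : zmodType) (s : seq nat) (T : nat -> V) :
  uniq s -> all prime s ->
  exists x, forall p, p \in s -> exists w, x = T p + w *+ p.
Proof.
elim: s => [|p s IHs] /=; first by exists 0.
move=> /andP[ps uniq_s] /andP[p_prime s_prime].
have [x xP] := IHs uniq_s s_prime.
pose M := (\prod_(q <- s) q)%N.
have M_gt0 : (0 < M)%N.
  by rewrite /M big_seq; apply: prodn_cond_gt0 => q /(allP s_prime)/prime_gt0.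
have M_coprime : coprime M p.
  rewrite /M big_seq; elim/big_ind: _ => [|a b ap bp|q qs]; first exact: coprime1n.
    by rewrite coprimeMl ap.
  rewrite coprime_sym prime_coprime // dvdn_prime2 ?(allP s_prime _ qs) //.
  by apply: contra ps => /eqP->.
have [u v uv _] := egcdnP p M_gt0.
rewrite (eqP M_coprime) in uv.
(* [u * M] is 1 modulo [p] and 0 modulo each prime of [s]. *)
exists (x + (T p - x) *+ (u * M)) => q; rewrite inE => /predU1P[->|qs].
  exists ((T p - x) *+ v); rewrite uv mulrnDr mulr1n mulrnA.
  by rewrite addrCA [x + _]addrC subrK addrC.
have [w def_x] := xP q qs; exists (w + (T p - x) *+ (u * (M %/ q))).
rewrite [(w + _) *+ q]mulrnDl addrA -def_x -mulrnA -mulnA divnK //.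
by rewrite /M (big_rem q) //= dvdn_mulr.
Qed.

Lemma int_horner_mem (R : comNzRingType) (S : set R) (x : R) (q : {poly int}) :
  is_subring S -> S x -> S (int_horner q x * x).
Proof.
case=> S_zmod SM Sx; elim/poly_ind: q => [|q c IHq].
  by rewrite /int_horner rmorph0 horner0 mul0r; exact: zmod_set0.
rewrite /int_horner rmorphD rmorphM /= map_polyX map_polyC hornerMXaddC mulrDl.
apply: zmod_setD => //; last by rewrite mulrzl; exact: zmod_setMz.
by apply/set_mem/SM; apply/mem_set.
Qed.

(** Given a cover, each [S i] stays proper modulo some prime [q i]. A [theta] generating modulo all
    these primes lies in some [S i], which is then everything modulo [q i]. Conversely, if nothing
    generates modulo [p], the subrings generated by one element together with the multiples of [p]
    are proper; one for each class modulo [p] suffices. *)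
Lemma generates_mod_coverable (K : fieldExtType rat) :
  finitely_coverable (ringOfIntegers K) <->
  exists2 p : nat, prime p & forall theta : ringOfIntegers K, ~ generates_mod p theta.
Proof.
have A_fg := ringOfIntegers_fin_gen K; split=> [[n [S [S_sub S_cover]]] | [p p_prime no_gen]].
  apply: contrapT => all_gen.
  have /choice[T TP] (p : nat) : exists theta : ringOfIntegers K,
      prime p -> generates_mod p theta.
    case: (boolP (prime p)) => [p_prime|_]; last by exists 0.
    by apply: contrapT => no_gen; case: all_gen; exists p => // theta theta_p;
      case: no_gen; exists theta.
  have /choice[q qP] i : exists p : nat, prime p /\
      exists x, forall s y, S i s -> x <> s + y *+ p.
    have [[Si_zmod _] Si_proper] := S_sub i.
    by have [p p_prime] := proper_subgroup_mod_prime A_fg Si_zmod Si_proper; exists p.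
  (* Different [S i] may share a prime, hence the removal of duplicates. *)
  have [|theta thetaP] := chinese_remainder_primes T (undup_uniq [seq q i | i <- enum 'I_n]).
    by apply/allP => p; rewrite mem_undup => /mapP[i _ ->]; case: (qP i).
  have [i _ Si_theta] : (\bigcup_i S i) theta by rewrite S_cover.
  have [q_prime [x xP]] := qP i.
  have [|w def_theta] := thetaP (q i); first by rewrite mem_undup map_f ?mem_enum.
  have [r [a def_x]] := generates_mod_congr (TP _ q_prime) def_theta x.
  by apply: (xP _ a _ def_x); apply: int_horner_mem => //; case: (S_sub i).
have p0 : p%:Z != 0 by rewrite -lt0n prime_gt0.
have [F [c cP]] := fin_gen_mod A_fg p0.
(* A colour that is not attained gets the representative 0, which is harmless: its subring is proper
   as well. *)
pose r f := xget 0 [set x | c x = f].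
pose S (i : 'I_#|F|) := [set x : ringOfIntegers K |
  exists q a, x = int_horner q (r (enum_val i)) * r (enum_val i) + a *+ p].
exists #|F|, S; split=> [i|]; last first.
  apply/seteqP; split=> // x _; exists (enum_rank (c x)) => //.
  rewrite /S /= enum_rankK.
  have /esym/cP[w def_x] : c (r (c x)) = c x.
    by apply: (@xgetPex _ 0 [set y | c y = c x]); exists x.
  by exists 1, w; rewrite /int_horner rmorph1 hornerE mul1r {1}def_x -pmulrn.
split; last first.
  move=> S_full; apply: (no_gen (r (enum_val i))) => x.
  by have : S i x by rewrite S_full.
rewrite /S; move: (r (enum_val i)) => t.
split; first split.
- by apply/mem_set; exists 0, 0; rewrite /int_horner rmorph0 horner0 mul0r mul0rn addr0.
- move=> _ _ /set_mem[q [a ->]] /set_mem[q' [a' ->]]; apply/mem_set.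
  exists (q - q'), (a - a').
  by rewrite /int_horner rmorphB hornerD hornerN mulrBl mulrnBl opprD addrACA.
- move=> _ _ /set_mem[q [a ->]] /set_mem[q' [a' ->]]; apply/mem_set.
  (* The extra ['X] comes from [q(t) t * q'(t) t = (q q' X)(t) t]. *)
  exists (q * q' * 'X).
  exists (int_horner q t * t * a' + a * (int_horner q' t * t) + a * a' *+ p).
  rewrite /int_horner !rmorphM /= map_polyX !hornerE -/(int_horner q t) -/(int_horner q' t).
  have [u mulp] : exists u : ringOfIntegers K, forall v, v *+ p = v * u.
    by exists p%:R => v; rewrite mulr_natr.
  by rewrite !mulp /=; ring.
Qed.

Theorem theorem12 (K : fieldExtType rat) :
  finitely_coverable (ringOfIntegers K) <->
  exists p : nat, prime p /\
    ((p %| field_index K)%N \/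
     exists P : 'I_p -> prime_idealr (ringOfIntegers K),
       (forall i j : 'I_p, P i =i P j -> i = j) /\
       (forall i : 'I_p,
          lies_over (P i) p /\ has_residue_degree p (P i) 1%N)).
Proof.
apply: (iff_trans (generates_mod_coverable K)).
split=> [[p p_prime no_gen] | [p [p_prime p_bad]]]; exists p => //.
  split=> //; apply: contrapT => /not_orP[/negP p_index noP].
  by have [theta] := generates_mod_exists p_prime p_index noP; exact: no_gen.
move=> theta theta_p; case: p_bad => [p_index|].
  by have := generates_mod_index p_prime theta_p; rewrite p_index.
exact: (generates_mod_primes p_prime theta_p).
Qed.
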